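(* For every polynomial time computable function $f:\{0,1\}^*\to\{0,1\}^*$ there exists a $\lambda$-term $t_f$ such that $;\vdash t_f:\mathbf{W}_{\mathrm{Church}}\Rightarrow\mathbf{W}_{\mathrm{Scott}}$ is derivable in $\mathrm{DIAL}$, and for every $w\in\{0,1\}^*$ the $\beta$-normal form of $t_f\,\underline{w}$ is $\overline{f(w)}$.
   Context: $\lambda$-terms: $t::=x\mid\lambda x.t\mid tu$. The system $\mathrm{DIAL}$: linear formulas $L,M::=\alpha\mid\forall\alpha L\mid\mu\alpha L\mid L\multimap M$ (where $\mu\alpha L$ may be formed only if $\alpha$ occurs only positively in $L$); formulas $A,B::=L\mid\forall\alpha A\mid L\multimap B\mid A\Rightarrow B$. Judgments $\Gamma;\Delta\vdash t:A$ where $\Delta$ assigns linear formulas and $\Gamma$ arbitrary formulas to distinct variables. Rules: (ax1) $x:A;\vdash x:A$; (ax2) $;x:L\vdash x:L$; ($\mu_e$) from $\Gamma;\Delta\vdash t:\mu\alpha L$ infer $\Gamma;\Delta\vdash t:L[\mu\alpha L/\alpha]$; ($\mu_i$) the converse; ($\forall_i$) from $\Gamma;\Delta\vdash t:A$ with $\alpha$ not free in $\Gamma,\Delta$ infer $\Gamma;\Delta\vdash t:\forall\alpha A$; ($\forall_e$) from $\Gamma;\Delta\vdash t:\forall\alpha A$ infer $\Gamma;\Delta\vdash t:A[L/\alpha]$ for $L$ linear; ($\Rightarrow_e$) from $\Gamma_1;\Delta\vdash t:A\Rightarrow B$ and $\Gamma_2;\vdash u:A$ infer $\Gamma_1,\Gamma_2;\Delta\vdash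 tu:B$; ($\Rightarrow_i$) from $\Gamma,z:A;\Delta\vdash t:B$ infer $\Gamma;\Delta\vdash\lambda z.t:A\Rightarrow B$; ($\multimap_e$) from $\Gamma_1;\Delta_1\vdash t:L\multimap B$ and $\Gamma_2;\Delta_2\vdash u:L$ infer $\Gamma_1,\Gamma_2;\Delta_1,\Delta_2\vdash tu:B$; ($\multimap_i$) from $\Gamma;\Delta,z:L\vdash t:B$ infer $\Gamma;\Delta\vdash\lambda z.t:L\multimap B$; (Contr) from $\Gamma,x:A,y:A;\Delta\vdash t:B$ infer $\Gamma,z:A;\Delta\vdash t[z/x,z/y]:B$; (Derel) from $\Gamma;\Delta,x:L\vdash t:B$ infer $\Gamma,x:L;\Delta\vdash t:B$; (Weak) from $\Gamma;\Delta\vdash t:B$ infer $\Gamma,\Gamma';\Delta,\Delta'\vdash t:B$. $\mathbf{W}_{\mathrm{Church}}=\forall\alpha(\alpha\multimap\alpha)\Rightarrow(\alpha\multimap\alpha)\Rightarrow(\alpha\multimap\alpha)$, $\underline{w}=\lambda f_0f_1x.f_{i_1}(f_{i_2}(\cdots f_{i_n}(x)\cdots))$ for $w=i_1\cdots i_n$; $\mathbf{W}_{\mathrm{Scott}}=\mu\beta\forall\alpha(\beta\multimap\alpha)\multimap(\beta\multimap\alpha)\multimap(\alpha\multimap\alpha)$, $\overline{\epsilon}=\lambda xyz.z$, $\overline{0w}=\lambda xyz.x\,\overline{w}$, $\overline{1w}=\lambda xyz.y\,\overline{w}$. *)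

(* Defs.v *)
From HB Require Import structures.
From mathcomp Require Import all_boot.
From Stdlib Require Import Relation_Operators.

Set Implicit Arguments.
Unset Strict Implicit.
Unset Printing Implicit Defensive.

(** * Lambda-terms *)

(* Terms up to alpha-equivalence: variables are de Bruijn indices. *)
Inductive term : Type :=
| tvar of nat
| tlam of term
| tapp of term & term.

Definition up_ren (r : nat -> nat) (i : nat) : nat :=
  if i is j.+1 then (r j).+1 else 0.

Fixpoint tren (r : nat -> nat) (t : term) : term :=
  match t with
  | tvar i => tvar (r i)
  | tlam t => tlam (tren (up_ren r) t)
  | tapp t u => tapp (tren r t) (tren r u)
  end.

Definition tup (s : nat -> term) (i : nat) : term :=
  if i is j.+1 then tren succn (s j) else tvar 0.

Fixpoint tsubst (s : nat -> term) (t : term) : term :=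
  match t with
  | tvar i => s i
  | tlam t => tlam (tsubst (tup s) t)
  | tapp t u => tapp (tsubst s t) (tsubst s u)
  end.

(* [tinst u t] is [t] with index 0 replaced by [u] and the other free indices
   lowered by one. *)
Definition tinst (u : term) : term -> term :=
  tsubst (fun i => if i is j.+1 then tvar j else u).

Inductive beta : term -> term -> Prop :=
| beta_red t u : beta (tapp (tlam t) u) (tinst u t)
| beta_lam t t' : beta t t' -> beta (tlam t) (tlam t')
| beta_appl t t' u : beta t t' -> beta (tapp t u) (tapp t' u)
| beta_appr t u u' : beta u u' -> beta (tapp t u) (tapp t u').

Definition beta_normal (t : term) : Prop := forall u, ~ beta t u.

Definition beta_nf_of (t u : term) : Prop :=
  clos_refl_trans term beta t u /\ beta_normal u.

(** * Formulas of DIAL *)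

(* Raw formulas, with de Bruijn indices for type variables; the two syntactic
   classes are carved out by [is_lin] and [is_form].  A single raw syntax is
   used because linear formulas are literally formulas. *)
Inductive form : Type :=
| fvar of nat
| fall of form
| fmu of form
| flolli of form & form
| farr of form & form.

Lemma form_comparable : comparable form.
Proof. by move=> A B; rewrite /decidable; do 2?decide equality. Defined.

HB.instance Definition _ := hasDecEq.Build form (compareP form_comparable).

Fixpoint fren (r : nat -> nat) (A : form) : form :=
  match A with
  | fvar i => fvar (r i)
  | fall A => fall (fren (up_ren r) A)
  | fmu A => fmu (fren (up_ren r) A)
  | flolli A B => flolli (fren r A) (fren r B)
  | farr A B => farr (fren r A) (fren r B)
  end.

Definition fup (s : nat -> form) (i : nat) : form :=
  if i is j.+1 then fren succn (s j) else fvar 0.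

Fixpoint fsubst (s : nat -> form) (A : form) : form :=
  match A with
  | fvar i => s i
  | fall A => fall (fsubst (fup s) A)
  | fmu A => fmu (fsubst (fup s) A)
  | flolli A B => flolli (fsubst s A) (fsubst s B)
  | farr A B => farr (fsubst s A) (fsubst s B)
  end.

Definition finst (L : form) : form -> form :=
  fsubst (fun i => if i is j.+1 then fvar j else L).

(* All free occurrences of variable [k] in [A] are positive ([p = true]),
   resp. negative ([p = false]). *)
Fixpoint occurs_only (p : bool) (k : nat) (A : form) : bool :=
  match A with
  | fvar i => (i == k) ==> p
  | fall A => occurs_only p k.+1 A
  | fmu A => occurs_only p k.+1 A
  | flolli A B => occurs_only (~~ p) k A && occurs_only p k B
  | farr A B => occurs_only (~~ p) k A && occurs_only p k B
  end.

(* L, M ::= a | forall a L | mu a L (a only positive in L) | L -o M *)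
Fixpoint is_lin (A : form) : bool :=
  match A with
  | fvar _ => true
  | fall A => is_lin A
  | fmu A => is_lin A && occurs_only true 0 A
  | flolli A B => is_lin A && is_lin B
  | farr _ _ => false
  end.

(* A, B ::= L | forall a A | L -o B | A => B *)
Fixpoint is_form (A : form) : bool :=
  match A with
  | fall B => is_form B
  | flolli L B => is_lin L && is_form B
  | farr B C => is_form B && is_form C
  | _ => is_lin A
  end.

(** * Typing *)

(* A context lists the pairs (free variable, formula); the order is immaterial
   (rule [ty_exch]), and the conditions on [dom] below keep the variables of
   the two contexts of a derivable judgment pairwise distinct. *)
Definition ctx := seq (nat * form).

Definition dom (C : ctx) : seq nat := [seq p.1 | p <- C].

Definition codom_all (P : pred form) (C : ctx) : bool := all (fun p => P p.2) C.

(* Passing under a lambda: the variables outside are shifted, so that 0 is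
   the fresh bound variable. *)
Definition under_lam (C : ctx) : ctx := [seq (p.1.+1, p.2) | p <- C].

(* Passing under a forall: type variable 0 is not free in [under_all C]. *)
Definition under_all (C : ctx) : ctx := [seq (p.1, fren succn p.2) | p <- C].

(* The renaming [z/x, z/y]. *)
Definition merge_vars (x y z : nat) (i : nat) : nat :=
  if (i == x) || (i == y) then z else i.

(* [dial G D t A] is the judgment G; D |- t : A.  Well-formedness is required
   wherever a rule introduces a new formula, so that in a derivable judgment
   [D] consists of linear formulas and [G], [A] of formulas. *)
Inductive dial : ctx -> ctx -> term -> form -> Prop :=
| ty_ax1 x A : is_form A ->
    dial [:: (x, A)] [::] (tvar x) A
| ty_ax2 x L : is_lin L ->
    dial [::] [:: (x, L)] (tvar x) L
| ty_mu_e G D t L :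
    dial G D t (fmu L) ->
    dial G D t (finst (fmu L) L)
| ty_mu_i G D t L : is_lin (fmu L) ->
    dial G D t (finst (fmu L) L) ->
    dial G D t (fmu L)
| ty_all_i G D t A :
    dial (under_all G) (under_all D) t A ->
    dial G D t (fall A)
| ty_all_e G D t A L : is_lin L ->
    dial G D t (fall A) ->
    dial G D t (finst L A)
| ty_arr_e G1 G2 D t u A B : uniq (dom (G1 ++ G2 ++ D)) ->
    dial G1 D t (farr A B) ->
    dial G2 [::] u A ->
    dial (G1 ++ G2) D (tapp t u) B
| ty_arr_i G D t A B :
    dial ((0, A) :: under_lam G) (under_lam D) t B ->
    dial G D (tlam t) (farr A B)
| ty_lolli_e G1 G2 D1 D2 t u L B : uniq (dom (G1 ++ G2 ++ D1 ++ D2)) ->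
    dial G1 D1 t (flolli L B) ->
    dial G2 D2 u L ->
    dial (G1 ++ G2) (D1 ++ D2) (tapp t u) B
| ty_lolli_i G D t L B :
    dial (under_lam G) ((0, L) :: under_lam D) t B ->
    dial G D (tlam t) (flolli L B)
| ty_contr G D t x y z A B : z \notin dom (G ++ D) ->
    dial ((x, A) :: (y, A) :: G) D t B ->
    dial ((z, A) :: G) D (tren (merge_vars x y z) t) B
| ty_derel G D t x L B :
    dial G ((x, L) :: D) t B ->
    dial ((x, L) :: G) D t B
| ty_weak G G' D D' t B :
    codom_all is_form G' -> codom_all is_lin D' ->
    uniq (dom (G ++ G' ++ D ++ D')) ->
    dial G D t B ->
    dial (G ++ G') (D ++ D') t B
| ty_exch G G' D D' t B : perm_eq G G' -> perm_eq D D' ->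
    dial G D t B ->
    dial G' D' t B.

(** * Binary words: [false] is the letter 0 and [true] the letter 1 *)

(* forall a. (a -o a) => (a -o a) => (a -o a) *)
Definition W_Church : form :=
  let aa := flolli (fvar 0) (fvar 0) in fall (farr aa (farr aa aa)).

(* mu b. forall a. (b -o a) -o (b -o a) -o (a -o a) *)
Definition W_Scott : form :=
  let ba := flolli (fvar 1) (fvar 0) in
  fmu (fall (flolli ba (flolli ba (flolli (fvar 0) (fvar 0))))).

(* Under the three lambdas f0, f1, x are the indices 2, 1, 0. *)
Definition church (w : seq bool) : term :=
  tlam (tlam (tlam
    (foldr (fun b t => tapp (tvar (if b then 1 else 2)) t) (tvar 0) w))).

(* Under the three lambdas x, y, z are the indices 2, 1, 0; the inner word is
   a closed term, so it needs no shift. *)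
Fixpoint scott (w : seq bool) : term :=
  match w with
  | [::] => tlam (tlam (tlam (tvar 0)))
  | b :: w' => tlam (tlam (tlam (tapp (tvar (if b then 1 else 2)) (scott w'))))
  end.

(** * Polynomial time *)

Inductive symbol (K : Type) : Type :=
| Blank
| Bit of bool
| Aux of K.
Arguments Blank {K}.
Arguments Bit {K}.

Inductive move : Type := MoveL | Stay | MoveR.

(* Deterministic one-tape Turing machines, with a finite set [tm_aux] of
   auxiliary tape symbols; the machine halts when [tm_trans] is [None]. *)
Record turing : Type := Turing {
  tm_state : finType;
  tm_aux : finType;
  tm_start : tm_state;
  tm_trans : tm_state -> symbol tm_aux ->
             option (tm_state * symbol tm_aux * move)
}.

(* The tape is infinite in both directions: [cf_left] lists the cells left of
   the head, nearest first, [cf_right] the scanned cell and those to its right;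
   all the cells not listed are blank. *)
Record config (M : turing) : Type := Config {
  cf_state : tm_state M;
  cf_left : seq (symbol (tm_aux M));
  cf_right : seq (symbol (tm_aux M))
}.

Definition tm_init (M : turing) (w : seq bool) : config M :=
  Config (tm_start M) [::] [seq Bit b | b <- w].

Definition tm_step (M : turing) (c : config M) : option (config M) :=
  let: Config q l r := c in
  if tm_trans q (head Blank r) is Some (q', a, d) then
    let r' := behead r in
    Some match d with
         | MoveL => Config q' (behead l) (head Blank l :: a :: r')
         | Stay => Config q' l (a :: r')
         | MoveR => Config q' (a :: l) r'
         end
  else None.

Fixpoint read_bits (K : Type) (s : seq (symbol K)) : seq bool :=
  if s is Bit b :: s' then b :: read_bits s' else [::].

(* The output is the block of bits that starts at the head and extends to the
   right up to the first cell that does not hold a bit. *)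
Fixpoint tm_halts_within (M : turing) (n : nat) (c : config M) (u : seq bool) :
    Prop :=
  match tm_step c, n with
  | None, _ => read_bits (cf_right c) = u
  | Some c', n'.+1 => tm_halts_within n' c' u
  | Some _, 0 => False
  end.

Definition polytime (f : seq bool -> seq bool) : Prop :=
  exists (M : turing) (c k : nat), forall w : seq bool,
    tm_halts_within (c * size w ^ k + c) (tm_init M w) (f w).

(* Main.v *)
(** All data are Scott-encoded by linear formulas: tape symbols and states by
    numbers, the two halves of the tape by lists, and a configuration by a
    triple.  A case analysis uses its argument once, so one machine step is a
    closed term of type [C -o C]; reading the output off a list is likewise one
    level of recursion, a closed term of type [(List -o W) -o (List -o W)].
    If a term [T : L -o L] without free linear variables iterates [F] [n] times,
    then [w T T] is again such a term and iterates [F] [n * |w|] times, so this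
    can be nested, which gives [(|w| + 2) ^ k] iterations for every [k].
    The only variable used more than once is [w], so contraction is needed only
    for terms of the form [fun w => (t w) (u w)] with [t] and [u] closed. *)

From HB Require Import structures.
Require Import Defs.
From mathcomp Require Import all_boot zify.
From Stdlib Require Import Relation_Operators.

Set Implicit Arguments.
Unset Strict Implicit.
Unset Printing Implicit Defensive.

Local Notation "t \@ u" := (tapp t u) (at level 25, left associativity).
Local Notation "A -o B" := (flolli A B) (at level 60, right associativity).
Local Notation red := (clos_refl_trans term beta).
Local Notation typed := (dial [::] [::]).

(** * Closed terms *)

Fixpoint occ (i : nat) (t : term) : bool :=
  match t with
  | tvar j => j == i
  | tlam t => occ i.+1 t
  | tapp t u => occ i t || occ i u
  end.

Definition closed (t : term) : Prop := forall i, occ i t = false.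

Lemma tren_fixed r t : (forall i, occ i t -> r i = i) -> tren r t = t.
Proof.
elim: t r => [i|t IH|t IHt u IHu] r /= rt.
- by rewrite rt.
- by rewrite IH // => -[|i] //= /rt ->.
- by rewrite IHt ?IHu // => i oi; apply: rt; rewrite oi ?orbT.
Qed.

Lemma tsubst_fixed s t : (forall i, occ i t -> s i = tvar i) -> tsubst s t = t.
Proof.
elim: t s => [i|t IH|t IHt u IHu] s /= st.
- by rewrite st.
- by rewrite IH // => -[|i] //= /st ->.
- by rewrite IHt ?IHu // => i oi; apply: st; rewrite oi ?orbT.
Qed.

Lemma tren_closed r t : closed t -> tren r t = t.
Proof. by move=> ct; apply: tren_fixed => i; rewrite ct. Qed.

Lemma tsubst_closed s t : closed t -> tsubst s t = t.
Proof. by move=> ct; apply: tsubst_fixed => i; rewrite ct. Qed.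

Lemma occ_closed i t : closed t -> occ i t = false.
Proof. exact. Qed.

Lemma closed_app t u : closed t -> closed u -> closed (t \@ u).
Proof. by move=> ct cu i; rewrite /= ct cu. Qed.

Lemma closed_iter_app n f x :
  closed f -> closed x -> closed (iter n (tapp f) x).
Proof. by move=> cf cx; elim: n => //= n; apply: closed_app. Qed.

Lemma occ_tren r t i : occ i (tren r t) -> exists2 j, occ j t & i = r j.
Proof.
elim: t r i => [j|t IH|t IHt u IHu] r i /=.
- by move=> /eqP <-; exists j.
- by move=> /IH[[|j] //= oj [->]]; exists j.
- by case/orP=> [/IHt|/IHu] [j oj ->]; exists j; rewrite // oj ?orbT.
Qed.

Lemma dom_cat C D : dom (C ++ D) = dom C ++ dom D.
Proof. exact: map_cat. Qed.

Lemma dom_under_lam C : dom (under_lam C) = map succn (dom C).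
Proof. by rewrite /dom -!map_comp. Qed.

Lemma dom_under_all C : dom (under_all C) = dom C.
Proof. by rewrite /dom -map_comp. Qed.

Lemma occ_dial G D t A i : dial G D t A -> occ i t -> i \in dom (G ++ D).
Proof.
move=> tA; elim: tA i => {G D t A} //=.
- by move=> x A _ i /eqP ->; rewrite mem_head.
- by move=> x L _ i /eqP ->; rewrite mem_head.
- by move=> G D t A _; rewrite !dom_cat !dom_under_all.
- move=> G1 G2 D t u A B _ _ IHt _ IHu i /orP[/IHt|/IHu];
    rewrite !dom_cat !mem_cat ?orbF; last by move=> ->; rewrite orbT.
  by case/orP=> ->; rewrite ?orbT.
- move=> G D t A B _ IH i /IH; rewrite inE /= -/(dom _) !dom_cat !dom_under_lam.
  by rewrite -map_cat (mem_map succn_inj).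
- move=> G1 G2 D1 D2 t u L B _ _ IHt _ IHu i /orP[/IHt|/IHu];
    by rewrite !dom_cat !mem_cat => /orP[] ->; rewrite ?orbT.
- move=> G D t L B _ IH i /IH; rewrite !dom_cat /= -/(dom _) !dom_under_lam.
  by rewrite mem_cat inE /= -mem_cat -map_cat (mem_map succn_inj).
- move=> G D t x y z A B _ _ IH i /occ_tren[j /IH jGD ->].
  move: jGD; rewrite !inE /merge_vars -/(dom _).
  by case: (j == x); case: (j == y); rewrite ?eqxx //= => ->; rewrite orbT.
- move=> G D t x L B _ IH i /IH; rewrite !inE !dom_cat /= -/(dom _).
  by rewrite !mem_cat inE orbCA.
- move=> G G' D D' t B _ _ _ _ IH i /IH; rewrite !dom_cat !mem_cat.
  by case/orP=> ->; rewrite ?orbT.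
- move=> G G' D D' t B pG pD _ IH i /IH.
  by rewrite (perm_mem (perm_map _ (perm_cat pG pD))).
Qed.

Lemma dial_closed t A : typed t A -> closed t.
Proof. by move=> tA i; apply/negP => /(occ_dial tA). Qed.

Create HintDb typed.
Create HintDb closed.

#[local] Hint Resolve closed_app : closed.
#[local] Hint Extern 1 (closed _) =>
  solve [eapply dial_closed; eauto 2 with typed nocore] : closed.
#[local] Hint Extern 0 (closed _) => solve [auto with closed nocore] : core.

(** * Reduction *)

Lemma red_trans t u v : red t u -> red u v -> red t v.
Proof. exact: rt_trans. Qed.

Lemma red_refl t : red t t.
Proof. exact: rt_refl. Qed.
#[local] Hint Resolve red_refl : core.

Lemma red_appl t t' u : red t t' -> red (t \@ u) (t' \@ u).
Proof.
elim=> [a b ab|//|a b c _ ab _ bc]; last exact: red_trans ab bc.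
exact/rt_step/beta_appl.
Qed.

Lemma red_appr t u u' : red u u' -> red (t \@ u) (t \@ u').
Proof.
elim=> [a b ab|//|a b c _ ab _ bc]; last exact: red_trans ab bc.
exact/rt_step/beta_appr.
Qed.

Lemma red_app t t' u u' : red t t' -> red u u' -> red (t \@ u) (t' \@ u').
Proof.
by move=> /red_appl tt' /red_appr uu'; apply: red_trans (tt' _) (uu' _).
Qed.

Fixpoint head_step (t : term) : term :=
  match t with
  | tapp (tlam t) u => tinst u t
  | tapp t u => head_step t \@ u
  | _ => t
  end.

Lemma red_head_step t : red t (head_step t).
Proof.
elim: t => // t IH u _; case: t IH => [i|t|t t'] IH //=; last exact: red_appl.
exact/rt_step/beta_red.
Qed.

(* Head reduction stops at defined constants, so that a reduction lemma about
   them can be applied next. *)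
Ltac has_head_redex t :=
  lazymatch t with
  | tapp (tlam _) _ => idtac
  | tapp ?t _ => has_head_redex t
  end.

Ltac head_reduce :=
  repeat (
    lazymatch goal with |- clos_refl_trans _ _ ?t _ => has_head_redex t end;
    apply: (red_trans (red_head_step _));
    cbn [head_step]; rewrite /tinst; cbn [tsubst tup tren up_ren];
    rewrite ?(tren_closed, tsubst_closed) //).

Lemma beta_normal_lam t : beta_normal t -> beta_normal (tlam t).
Proof. by move=> nt u tu; inversion tu as [|? t' tt'| |]; apply: nt tt'. Qed.

Lemma beta_normal_var i : beta_normal (tvar i).
Proof. by move=> u iu; inversion iu. Qed.

Lemma beta_normal_app_var i t : beta_normal t -> beta_normal (tvar i \@ t).
Proof.
move=> nt u tu; inversion tu as [| |? i' ? ii'|? ? t' tt'].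
  exact: beta_normal_var ii'.
exact: nt tt'.
Qed.

Lemma scott_normal w : beta_normal (scott w).
Proof.
elim: w => [|b w IH] /=; do 3 apply: beta_normal_lam.
  exact: beta_normal_var.
exact: beta_normal_app_var.
Qed.

Lemma scott_closed w : closed (scott w).
Proof. by elim: w => //= b w IH i /=; rewrite IH; case: b. Qed.
#[local] Hint Resolve scott_closed : closed.

Lemma church_closed w : closed (church w).
Proof. by move=> i /=; elim: w => //= b w ->; case: b. Qed.
#[local] Hint Resolve church_closed : closed.

Lemma tsubst_word s w a b c :
  tsubst s (foldr (fun i t => (if i then b else a) \@ t) c w) =
  foldr (fun i t => (if i then tsubst s b else tsubst s a) \@ t) (tsubst s c) w.
Proof. by elim: w => //= -[] w ->. Qed.

Lemma church_red w a b x : closed a -> closed b -> closed x ->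
  red (church w \@ a \@ b \@ x)
      (foldr (fun i t => (if i then b else a) \@ t) x w).
Proof.
move=> ca cb cx.
have -> : church w = tlam (tlam (tlam
    (foldr (fun i t => (if i then tvar 1 else tvar 2) \@ t) (tvar 0) w))).
  by congr (tlam (tlam (tlam _))); elim: w => //= -[] w ->.
do 3 (apply: (red_trans (red_head_step _));
  rewrite /= /tinst /= tsubst_word /= ?(tren_closed, tsubst_closed) //).
Qed.

(** * Affine typing *)

(* The linear context of [t] in the de Bruijn environment [E] keeps the free
   variables of [t] only, which makes the splitting of contexts automatic. *)
Fixpoint ctx_of (k : nat) (E : seq form) (t : term) : ctx :=
  if E is L :: E' then
    if occ k t then (k, L) :: ctx_of k.+1 E' t else ctx_of k.+1 E' t
  else [::].

Definition aff (E : seq form) (t : term) (A : form) : Prop :=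
  dial [::] (ctx_of 0 E t) t A.

Lemma ctx_of_closed k E t : closed t -> ctx_of k E t = [::].
Proof. by move=> ct; elim: E k => //= L E IH k; rewrite ct. Qed.

Lemma ctx_of_lam k E t : under_lam (ctx_of k E (tlam t)) = ctx_of k.+1 E t.
Proof. by elim: E k => //= L E IH k; case: ifP => _ /=; rewrite IH. Qed.

Lemma ctx_of_all k E t :
  under_all (ctx_of k E t) = ctx_of k (map (fren succn) E) t.
Proof. by elim: E k => //= L E IH k; case: ifP => _ /=; rewrite IH. Qed.

Lemma dom_ctx_of k E t i : i \in dom (ctx_of k E t) -> (k <= i) && occ i t.
Proof.
elim: E k => //= L E IH k; case: ifP => [ok|_].
  rewrite inE => /predU1P[->|/IH/andP[/ltnW-> //]]; by rewrite leqnn.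
by move=> /IH/andP[/ltnW-> ->].
Qed.

Lemma uniq_ctx_of k E t : uniq (dom (ctx_of k E t)).
Proof.
elim: E k => //= L E IH k; case: ifP => //= _; rewrite IH andbT.
by apply/negP => /dom_ctx_of; rewrite ltnn.
Qed.

Lemma ctx_of_var_lt k i E : i < k -> ctx_of k E (tvar i) = [::].
Proof. by elim: E k => //= L E IH k ik; rewrite ltn_eqF // IH // ltnW. Qed.

Lemma ctx_of_var k i E :
  i < size E -> ctx_of k E (tvar (k + i)) = [:: (k + i, nth (fvar 0) E i)].
Proof.
elim: E k i => //= L E IH k [|i] iE /=.
  by rewrite addn0 eqxx ctx_of_var_lt.
by rewrite -[X in _ == X]addn0 eqn_add2l /= addnS -addSn IH.
Qed.

Definition disjoint_occ (k n : nat) (t u : term) : bool :=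
  all (fun i => ~~ (occ i t && occ i u)) (iota k n).

Lemma perm_ctx_of_app k E t u : disjoint_occ k (size E) t u ->
  perm_eq (ctx_of k E t ++ ctx_of k E u) (ctx_of k E (t \@ u)).
Proof.
elim: E k => //= L E IH k /andP[nk /IH pE].
case: (occ k t) nk => /= [/negPf->|_]; first by rewrite perm_cons.
case: (occ k u) => //.
by rewrite perm_catC /= perm_cons perm_catC.
Qed.

Lemma aff_app E t u L B :
    aff E t (L -o B) -> aff E u L -> disjoint_occ 0 (size E) t u ->
  aff E (t \@ u) B.
Proof.
move=> tA uA dtu; have pE := perm_ctx_of_app dtu.
apply: (ty_exch (perm_refl _) pE).
apply: (ty_lolli_e (G1 := [::]) (G2 := [::]) _ tA uA) => /=.
by rewrite (perm_uniq (perm_map _ pE)) uniq_ctx_of.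
Qed.

Lemma aff_lam E t L B : is_lin L -> aff (L :: E) t B -> aff E (tlam t) (L -o B).
Proof.
move=> linL; rewrite /aff /= -ctx_of_lam => tB; apply: ty_lolli_i.
case: ifP tB => // o0 tB.
apply: (ty_exch (perm_refl _)
  (D := under_lam (ctx_of 0 E (tlam t)) ++ [:: (0, L)])).
  by rewrite perm_catC.
apply: (ty_weak (G := [::]) (G' := [::])) => //=; first by rewrite linL.
rewrite dom_cat cat_uniq /= orbF andbT ctx_of_lam uniq_ctx_of /=.
by apply/negP => /dom_ctx_of.
Qed.

Lemma aff_var E i A :
  nth (fvar 0) E i = A -> i < size E -> is_lin A -> aff E (tvar i) A.
Proof. by move=> <- iE lE; rewrite /aff (ctx_of_var 0 iE); apply: ty_ax2. Qed.

Lemma aff_all_i E t A : aff (map (fren succn) E) t A -> aff E t (fall A).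
Proof. by move=> tA; apply: ty_all_i; rewrite ctx_of_all. Qed.

Lemma aff_typed E t A : typed t A -> aff E t A.
Proof. by move=> tA; rewrite /aff ctx_of_closed //; apply: dial_closed tA. Qed.

(** * Data types *)

Definition nat_form : form :=
  fmu (fall ((fvar 1 -o fvar 0) -o fvar 0 -o fvar 0)).

Definition list_form : form :=
  fmu (fall ((nat_form -o fvar 1 -o fvar 0) -o fvar 0 -o fvar 0)).

Definition config_form : form :=
  fall ((nat_form -o list_form -o list_form -o fvar 0) -o fvar 0).

Lemma aff_nat_intro E t :
  aff (map (fren succn) E) t ((nat_form -o fvar 0) -o fvar 0 -o fvar 0) ->
  aff E t nat_form.
Proof. by move=> tA; apply/ty_mu_i/aff_all_i. Qed.

Lemma aff_list_intro E t :
  aff (map (fren succn) E) t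
    ((nat_form -o list_form -o fvar 0) -o fvar 0 -o fvar 0) ->
  aff E t list_form.
Proof. by move=> tA; apply/ty_mu_i/aff_all_i. Qed.

Lemma aff_config_intro E t :
  aff (map (fren succn) E) t
    ((nat_form -o list_form -o list_form -o fvar 0) -o fvar 0) ->
  aff E t config_form.
Proof. exact: aff_all_i. Qed.

Lemma aff_Scott_intro E t :
  aff (map (fren succn) E) t
    ((W_Scott -o fvar 0) -o (W_Scott -o fvar 0) -o fvar 0 -o fvar 0) ->
  aff E t W_Scott.
Proof. by move=> tA; apply/ty_mu_i/aff_all_i. Qed.

Lemma aff_nat_elim E t X : is_lin X -> aff E t nat_form ->
  aff E t ((nat_form -o X) -o X -o X).
Proof. by move=> linX tN; apply: ty_all_e linX (ty_mu_e tN). Qed.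

Lemma aff_list_elim E t X : is_lin X -> aff E t list_form ->
  aff E t ((nat_form -o list_form -o X) -o X -o X).
Proof. by move=> linX tN; apply: ty_all_e linX (ty_mu_e tN). Qed.

Lemma aff_config_elim E t X : is_lin X -> aff E t config_form ->
  aff E t ((nat_form -o list_form -o list_form -o X) -o X).
Proof. by move=> linX tN; apply: ty_all_e linX tN. Qed.

(* [andbb] disposes of [is_lin X && is_lin X] when [is_lin X] is assumed. *)
Ltac linear := by rewrite //= ?andbb.

Ltac affine_var := by apply: aff_var; linear.

(* The formula of an argument that is a variable is read off the environment;
   for other arguments it is found when the function is typed. *)
Ltac aff_step :=
  lazymatch goal with
  | |- dial [::] [::] ?t ?A => change (aff [::] t A)
  | |- aff _ (tlam _) (flolli _ _) => apply: aff_lam; [linear|]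
  | |- aff _ (tlam _) nat_form => apply: aff_nat_intro
  | |- aff _ (tlam _) list_form => apply: aff_list_intro
  | |- aff _ (tlam _) config_form => apply: aff_config_intro
  | |- aff _ (tlam _) W_Scott => apply: aff_Scott_intro
  | |- aff _ (tvar _) _ => first
      [ affine_var
      | apply: aff_nat_elim; [linear|affine_var]
      | apply: aff_list_elim; [linear|affine_var]
      | apply: aff_config_elim; [linear|affine_var] ]
  | |- aff ?E (tapp _ (tvar ?i)) _ =>
      let L := eval cbn [nth map] in (nth (fvar 0) E i) in
      apply: (aff_app (L := L))
  | |- aff _ (tapp _ _) _ => eapply aff_app
  | |- aff _ _ _ => eapply aff_typed; solve [eauto 3 with typed]
  | |- is_true (disjoint_occ _ _ _ _) =>
      by rewrite /disjoint_occ; cbn [size map iota all occ]; rewrite ?occ_closed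
  end.

Ltac affine := repeat aff_step.

Fixpoint enc_nat (n : nat) : term :=
  if n is m.+1 then tlam (tlam (tvar 1 \@ enc_nat m))
  else tlam (tlam (tvar 0)).

Lemma enc_nat_typed n : typed (enc_nat n) nat_form.
Proof. by elim: n => [|n IH] /=; affine. Qed.
#[local] Hint Resolve enc_nat_typed : typed.

Fixpoint nat_case (n : nat) (g : nat -> term) : term :=
  if n is m.+1 then tlam (tvar 0 \@ nat_case m (g \o succn) \@ g 0)
  else tlam (g 0).

Lemma nat_case_typed n g X : is_lin X -> (forall i, typed (g i) X) ->
  typed (nat_case n g) (nat_form -o X).
Proof.
move=> linX; elim: n g => [|n IH] g gX /=; first by have g0 := gX 0; affine.
have [g0 gS] := (gX 0, IH (g \o succn) (fun i => gX i.+1)).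
affine.
Qed.

Lemma nat_case_closed n g : (forall i, closed (g i)) -> closed (nat_case n g).
Proof.
elim: n g => [|n IH] g cg i /=; first by rewrite cg.
by rewrite IH ?cg // => j; apply: cg.
Qed.

Lemma nat_case_red n g i : (forall j, closed (g j)) -> i <= n ->
  red (nat_case n g \@ enc_nat i) (g i).
Proof.
move=> cg; elim: n i g cg => [|n IH] i g cg /=.
  by rewrite leqn0 => /eqP->; head_reduce.
have cS : closed (nat_case n (g \o succn)).
  by apply: nat_case_closed => j; apply: cg.
by case: i => [_|i le_in] /=; head_reduce; apply: (IH i _ (fun j => cg j.+1)).
Qed.

Definition enc (T : countType) (x : T) : term := enc_nat (pickle x).

Definition fin_case (T : finType) (x0 : T) (g : T -> term) : term :=
  nat_case (\max_x pickle (x : T)) (fun i => g (odflt x0 (unpickle i))).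

Lemma fin_case_typed (T : finType) (x0 : T) g X : is_lin X ->
  (forall x, typed (g x) X) -> typed (fin_case x0 g) (nat_form -o X).
Proof. by move=> linX gX; apply: nat_case_typed. Qed.

Lemma fin_case_red (T : finType) (x0 : T) g x : (forall x, closed (g x)) ->
  red (fin_case x0 g \@ enc x) (g x).
Proof.
move=> cg; rewrite -{2}[x]/(odflt x0 (Some x)) -pickleK.
exact: nat_case_red (leq_bigmax x).
Qed.

Definition nil_term : term := tlam (tlam (tvar 0)).

Definition cons_term : term :=
  tlam (tlam (tlam (tlam (tvar 1 \@ tvar 3 \@ tvar 2)))).

Lemma nil_typed : typed nil_term list_form.
Proof. by rewrite /nil_term; affine. Qed.
#[local] Hint Resolve nil_typed : typed.

Lemma cons_typed : typed cons_term (nat_form -o list_form -o list_form).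
Proof. by rewrite /cons_term; affine. Qed.
#[local] Hint Resolve cons_typed : typed.

Fixpoint enc_list (T : countType) (s : seq T) : term :=
  if s is x :: s' then tlam (tlam (tvar 1 \@ enc x \@ enc_list s'))
  else nil_term.

Lemma enc_list_typed (T : countType) (s : seq T) : typed (enc_list s) list_form.
Proof. by elim: s => [|x s IH] /=; affine. Qed.
#[local] Hint Resolve enc_list_typed : typed.

Lemma cons_red (T : countType) (x : T) s t : red t (enc_list s) ->
  red (cons_term \@ enc x \@ t) (enc_list (x :: s)).
Proof.
move=> ts; apply: red_trans (red_appr _ ts) _.
by rewrite /cons_term; head_reduce.
Qed.

(* The continuation is bound only after the case analysis: a single use of it
   then serves both branches. *)
Definition uncons_term (T : countType) (x0 : T) : term :=
  tlam (tvar 0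
    \@ tlam (tlam (tlam (tvar 0 \@ tvar 2 \@ tvar 1)))
    \@ tlam (tvar 0 \@ enc x0 \@ nil_term)).

Lemma uncons_typed (T : countType) (x0 : T) X : is_lin X ->
  typed (uncons_term x0) (list_form -o (nat_form -o list_form -o X) -o X).
Proof. by move=> linX; rewrite /uncons_term; affine. Qed.
#[local] Hint Resolve uncons_typed : typed.

Lemma uncons_red (T : countType) (x0 : T) s k :
  red (uncons_term x0 \@ enc_list s \@ k)
      (k \@ enc (head x0 s) \@ enc_list (behead s)).
Proof.
by case: s => [|x s]; rewrite /uncons_term /= /nil_term; head_reduce.
Qed.

Definition nilW_term : term := tlam (tlam (tlam (tvar 0))).

Definition consW_term (b : bool) : term :=
  tlam (tlam (tlam (tlam (tvar (if b then 1 else 2) \@ tvar 3)))).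

Lemma nilW_typed : typed nilW_term W_Scott.
Proof. by rewrite /nilW_term; affine. Qed.
#[local] Hint Resolve nilW_typed : typed.

Lemma consW_typed b : typed (consW_term b) (W_Scott -o W_Scott).
Proof. by case: b; rewrite /consW_term; affine. Qed.
#[local] Hint Resolve consW_typed : typed.

Lemma consW_red b t w : red t (scott w) ->
  red (consW_term b \@ t) (scott (b :: w)).
Proof.
move=> tw; apply: red_trans (red_appr _ tw) _.
by rewrite /consW_term; head_reduce; case: b.
Qed.

Definition config_term : term :=
  tlam (tlam (tlam (tlam (tvar 0 \@ tvar 3 \@ tvar 2 \@ tvar 1)))).

Lemma config_typed :
  typed config_term (nat_form -o list_form -o list_form -o config_form).
Proof. by rewrite /config_term; affine. Qed.
#[local] Hint Resolve config_typed : typed.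

(** * Simulation of a machine *)

Section SymbolFinite.

Variable K : finType.

Definition option_of_symbol (a : symbol K) : option (bool + K) :=
  match a with
  | Blank => None
  | Bit b => Some (inl b)
  | Aux k => Some (inr k)
  end.

Definition symbol_of_option (x : option (bool + K)) : symbol K :=
  match x with
  | None => Blank
  | Some (inl b) => Bit b
  | Some (inr k) => Aux k
  end.

Lemma option_of_symbolK : cancel option_of_symbol symbol_of_option.
Proof. by case. Qed.

HB.instance Definition _ := Finite.copy (symbol K) (can_type option_of_symbolK).

End SymbolFinite.

Section Machine.

Variable M : turing.
Local Notation sym := (symbol (tm_aux M)).

Definition enc_config (c : config M) : term :=
  tlam (tvar 0 \@ enc (cf_state c) \@ enc_list (cf_left c)
          \@ enc_list (cf_right c)).

Lemma enc_config_typed c : typed (enc_config c) config_form.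
Proof. by rewrite /enc_config; affine. Qed.

Lemma config_red (q : tm_state M) (l r : seq sym) t u :
    red t (enc_list l) -> red u (enc_list r) ->
  red (config_term \@ enc q \@ t \@ u) (enc_config (Config q l r)).
Proof.
move=> tl ur; apply: red_trans (red_app (red_appr _ tl) ur) _.
by rewrite /config_term; head_reduce.
Qed.

Definition write_move (d : move) (q : tm_state M) (b : sym) (l r : seq sym) :
    config M :=
  match d with
  | MoveL => Config q (behead l) (head Blank l :: b :: r)
  | Stay => Config q l (b :: r)
  | MoveR => Config q (b :: l) r
  end.

Definition write_move_term (d : move) (q : tm_state M) (b : sym) : term :=
  match d with
  | MoveL => tlam (uncons_term (Blank : sym) \@ tvar 0
      \@ tlam (tlam (tlam (config_term \@ enc q \@ tvar 1
           \@ (cons_term \@ tvar 2 \@ (cons_term \@ enc b \@ tvar 0))))))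
  | Stay => tlam (tlam (config_term \@ enc q \@ tvar 1
      \@ (cons_term \@ enc b \@ tvar 0)))
  | MoveR => tlam (tlam (config_term \@ enc q
      \@ (cons_term \@ enc b \@ tvar 1) \@ tvar 0))
  end.

Lemma write_move_typed d q b :
  typed (write_move_term d q b) (list_form -o list_form -o config_form).
Proof. by case: d; rewrite /write_move_term; affine. Qed.

Lemma write_move_red d q b (l r : seq sym) :
  red (write_move_term d q b \@ enc_list l \@ enc_list r)
      (enc_config (write_move d q b l r)).
Proof.
case: d; rewrite /write_move_term; head_reduce.
- apply: red_trans (red_appl _ (uncons_red _ _ _)) _; head_reduce.
  exact/config_red/cons_red/cons_red.
- exact/config_red/cons_red.
- exact/config_red/red_refl/cons_red.
Qed.

(* A halted machine keeps its configuration, up to an explicit blank under the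
   head, instead of having no successor. *)
Definition total_trans (q : tm_state M) (a : sym) : tm_state M * sym * move :=
  odflt (q, a, Stay) (tm_trans q a).

Definition total_step (c : config M) : config M :=
  let: Config q l r := c in
  let: (q', b, d) := total_trans q (head Blank r) in
  write_move d q' b l (behead r).

Definition act_term (q : tm_state M) (a : sym) : term :=
  let: (q', b, d) := total_trans q a in write_move_term d q' b.

Lemma act_typed q a :
  typed (act_term q a) (list_form -o list_form -o config_form).
Proof.
by rewrite /act_term; case: total_trans => [[q' b] d]; apply: write_move_typed.
Qed.
#[local] Hint Resolve act_typed : typed.

Definition trans_term : term :=
  fin_case (tm_start M) (fun q => fin_case Blank (act_term q)).

Lemma act_case_typed q : typed (fin_case Blank (act_term q))
  (nat_form -o list_form -o list_form -o config_form).
Proof. exact/fin_case_typed/act_typed. Qed.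
#[local] Hint Resolve act_case_typed : typed.

Lemma trans_typed : typed trans_term
  (nat_form -o nat_form -o list_form -o list_form -o config_form).
Proof. exact/fin_case_typed/act_case_typed. Qed.
#[local] Hint Resolve trans_typed : typed.

Lemma trans_red q (l r : seq sym) :
  red (trans_term \@ enc q \@ enc (head Blank r) \@ enc_list l
         \@ enc_list (behead r))
      (enc_config (total_step (Config q l r))).
Proof.
apply: (red_trans (u := act_term q (head Blank r) \@ enc_list l
    \@ enc_list (behead r))).
  do 2 apply: red_appl.
  by apply: red_trans (red_appl _ (fin_case_red _ _ _)) (fin_case_red _ _ _).
rewrite /act_term /=; case: total_trans => [[q' b] d]; exact: write_move_red.
Qed.

Definition step_term : term :=
  tlam (tvar 0 \@ tlam (tlam (tlam
    (uncons_term (Blank : sym) \@ tvar 0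
       \@ tlam (tlam (tlam (tlam
            (trans_term \@ tvar 1 \@ tvar 3 \@ tvar 0 \@ tvar 2))))
       \@ tvar 2 \@ tvar 1)))).

Lemma step_typed : typed step_term (config_form -o config_form).
Proof. by rewrite /step_term; affine. Qed.

Lemma step_red c :
  red (step_term \@ enc_config c) (enc_config (total_step c)).
Proof.
case: c => q l r; rewrite /step_term /enc_config /=; head_reduce.
apply: red_trans (red_appl _ (red_appl _ (uncons_red _ _ _))) _; head_reduce.
exact: trans_red.
Qed.

Lemma iter_step_red n c :
  red (iter n (tapp step_term) (enc_config c))
      (enc_config (iter n total_step c)).
Proof.
elim: n => [|n IH] //=.
exact: red_trans (red_appr _ IH) (step_red _).
Qed.

Lemma total_step_Some c c' : tm_step c = Some c' -> total_step c = c'.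
Proof.
case: c => q l r; rewrite /= /total_trans.
by case: tm_trans => // -[[q' b] []] [].
Qed.

Lemma total_step_None c : tm_step c = None ->
  tm_step (total_step c) = None /\
  read_bits (cf_right (total_step c)) = read_bits (cf_right c).
Proof.
case: c => q l r /=; rewrite /total_trans.
case no_trans: tm_trans => [[[q' b] []]|] //= _.
by rewrite no_trans; case: r no_trans.
Qed.

Lemma iter_total_step_halts n m c u : tm_halts_within n c u -> n <= m ->
  read_bits (cf_right (iter m total_step c)) = u.
Proof.
elim: m n c => [|m IH] n c; first by case: n => //=; case: tm_step.
rewrite iterSr; case stepc: (tm_step c) => [c'|].
  by case: n => [|n] /=; rewrite stepc ?(total_step_Some stepc) //; apply: IH.
have [still_halted same_output] := total_step_None stepc => hc _.
apply: (IH 0) => //=; rewrite still_halted same_output.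
by case: n hc => /=; rewrite stepc.
Qed.

Lemma size_right_total_step c :
  size (cf_right (total_step c)) <= (size (cf_right c)).+2.
Proof.
case: c => q l r /=; case: total_trans => [[q' b] []] /=; rewrite size_behead;
  lia.
Qed.

Lemma size_right_iter n c :
  size (cf_right (iter n total_step c)) <= size (cf_right c) + n.*2.
Proof.
elim: n => [|n IH] /=; first by rewrite addn0.
by rewrite (leq_trans (size_right_total_step _)) // doubleS !addnS !ltnS.
Qed.

Local Notation reader_form := (list_form -o W_Scott).

Definition emit_branch (a : sym) : term :=
  if a is Bit b then tlam (tlam (consW_term b \@ (tvar 0 \@ tvar 1)))
  else tlam (tlam nilW_term).

Lemma emit_branch_typed a :
  typed (emit_branch a) (list_form -o reader_form -o W_Scott).
Proof. by case: a => [|b|k] /=; affine. Qed.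
#[local] Hint Resolve emit_branch_typed : typed.

Definition emit_term : term := fin_case Blank emit_branch.

Lemma emit_typed :
  typed emit_term (nat_form -o list_form -o reader_form -o W_Scott).
Proof. exact/fin_case_typed/emit_branch_typed. Qed.
#[local] Hint Resolve emit_typed : typed.

Definition read_term : term :=
  tlam (tlam (uncons_term (Blank : sym) \@ tvar 0 \@ emit_term \@ tvar 1)).

Lemma read_typed : typed read_term (reader_form -o reader_form).
Proof. by rewrite /read_term; affine. Qed.
#[local] Hint Resolve read_typed : typed.

Definition reads (n : nat) (g : term) : Prop :=
  forall s : seq sym, size s <= n ->
    red (g \@ enc_list s) (scott (read_bits s)).

Lemma reads_nil : reads 0 (tlam nilW_term).
Proof. by case=> // _; head_reduce. Qed.

Lemma reads_step n g : closed g -> reads n g -> reads n.+1 (read_term \@ g).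
Proof.
move=> cg gn s sn; rewrite /read_term; head_reduce.
apply: red_trans (red_appl _ (uncons_red _ _ _)) _.
apply: red_trans (red_appl _ (red_appl _ (fin_case_red _ _ _))) _ => //.
have sn' : size (behead s) <= n by rewrite size_behead; case: (size s) sn.
case: s sn' {sn} => [|[|b|k] s] /= sn; head_reduce => //.
exact/consW_red/gn.
Qed.

Lemma reads_iter n : reads n (iter n (tapp read_term) (tlam nilW_term)).
Proof.
elim: n => [|n IH]; first exact: reads_nil.
by apply: reads_step => //; apply: closed_iter_app.
Qed.

End Machine.

#[local] Hint Resolve enc_config_typed step_typed : typed.

(** * Applicative combinators *)

Definition pure (t : term) : term := tlam t.
Definition share (t u : term) : term := tlam (t \@ tvar 0 \@ (u \@ tvar 0)).
Definition ask : term := tlam (tvar 0).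

Local Notation "t <*> u" := (share t u) (at level 50, left associativity).

Lemma pure_typed C t A : is_form C -> typed t A -> typed (pure t) (farr C A).
Proof.
move=> formC tA; apply: ty_arr_i.
by apply: (ty_weak (G := [::]) (G' := [:: (0, C)]) (D := [::]) (D' := [::]));
  rewrite //= formC.
Qed.

Lemma dial_app_var C t A x : is_form C -> typed t (farr C A) ->
  dial [:: (x, C)] [::] (t \@ tvar x) A.
Proof.
move=> formC tA; apply: (ty_arr_e (G1 := [::]) (G2 := [:: (x, C)]) _ tA) => //.
exact: ty_ax1.
Qed.

(* The two uses of the argument are typed with distinct variables, 0 and 1,
   which are then contracted. *)
Lemma share_typed C t u A : closed t -> closed u ->
  dial [:: (0, C); (1, C)] [::] (t \@ tvar 0 \@ (u \@ tvar 1)) A ->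
  typed (t <*> u) (farr C A).
Proof.
move=> ct cu tuA; apply: ty_arr_i.
have -> : t \@ tvar 0 \@ (u \@ tvar 0) =
    tren (merge_vars 0 1 0) (t \@ tvar 0 \@ (u \@ tvar 1)).
  by rewrite /= !tren_closed.
exact: ty_contr.
Qed.

Lemma share_arr_typed C A B t u : is_form C ->
    typed t (farr C (farr A B)) -> typed u (farr C A) ->
  typed (t <*> u) (farr C B).
Proof.
move=> formC tAB uA.
apply: share_typed; [exact: dial_closed tAB|exact: dial_closed uA|].
by apply: (ty_arr_e (G1 := [:: (0, C)]) (G2 := [:: (1, C)]));
  [|exact: dial_app_var tAB|exact: dial_app_var uA].
Qed.

Lemma share_lolli_typed C L B t u : is_form C ->
    typed t (farr C (L -o B)) -> typed u (farr C L) ->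
  typed (t <*> u) (farr C B).
Proof.
move=> formC tLB uL.
apply: share_typed; [exact: dial_closed tLB|exact: dial_closed uL|].
by apply: (ty_lolli_e (G1 := [:: (0, C)]) (G2 := [:: (1, C)])
    (D1 := [::]) (D2 := [::]));
  [|exact: dial_app_var tLB|exact: dial_app_var uL].
Qed.

Lemma ask_Church_typed L : is_lin L ->
  typed ask (farr W_Church (farr (L -o L) (farr (L -o L) (L -o L)))).
Proof.
move=> linL; apply: ty_arr_i.
exact: (ty_all_e linL (ty_ax1 0 (A := W_Church) _)).
Qed.

Definition maps_to (v t a : term) : Prop := closed t /\ red (t \@ v) a.

Lemma maps_to_red v t a b : maps_to v t a -> red a b -> maps_to v t b.
Proof. by case=> ct ta ab; split=> //; apply: red_trans ta ab. Qed.

Lemma maps_to_refl v t : closed t -> maps_to v t (t \@ v).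
Proof. by []. Qed.

Lemma maps_to_pure v t : closed t -> maps_to v (pure t) t.
Proof. by move=> ct; split=> [i|]; rewrite /pure /= ?ct //; head_reduce. Qed.

Lemma maps_to_ask v : maps_to v ask v.
Proof. by split=> //; rewrite /ask; head_reduce. Qed.

Lemma maps_to_share v t u a b :
  maps_to v t a -> maps_to v u b -> maps_to v (t <*> u) (a \@ b).
Proof.
move=> [ct ta] [cu ub]; split=> [i|]; first by rewrite /= ct cu.
by rewrite /share; head_reduce; apply: red_app.
Qed.

(** * Polynomial iteration *)

Definition iterates (f : term) (n : nat) (t : term) : Prop :=
  forall x, closed x -> red (t \@ x) (iter n (tapp f) x).

Lemma iterates_red f n t u : red t u -> iterates f n u -> iterates f n t.
Proof. by move=> tu fu x cx; apply: red_trans (red_appl _ tu) (fu _ cx). Qed.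

Lemma iterates_church f n t w : closed f -> closed t -> iterates f n t ->
  iterates f (n * size w) (church w \@ t \@ t).
Proof.
move=> cf ct ft x cx; apply: red_trans (church_red _ _ _ _) _ => //.
elim: w => [|b w IH] /=; first by rewrite muln0.
apply: red_trans (red_appr _ IH) _; rewrite if_same mulnS iterD.
exact/ft/closed_iter_app.
Qed.

Definition comp_term : term :=
  tlam (tlam (tlam (tvar 2 \@ (tvar 1 \@ tvar 0)))).

Lemma comp_typed L :
  is_lin L -> typed comp_term ((L -o L) -o (L -o L) -o L -o L).
Proof. by move=> linL; rewrite /comp_term; affine. Qed.

Lemma comp_closed : closed comp_term.
Proof. by []. Qed.
#[local] Hint Resolve comp_closed : closed.

Lemma iterates_comp f m n t u : closed f -> closed t -> closed u ->
  iterates f m t -> iterates f n u -> iterates f (m + n) (comp_term \@ t \@ u).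
Proof.
move=> cf ct cu ft fu x cx; rewrite /comp_term; head_reduce.
rewrite iterD; apply: red_trans (red_appr _ (fu _ cx)) _.
exact/ft/closed_iter_app.
Qed.

(* If [t w] iterates [f] [n] times, then [comp (comp t t) (w t t)], with the
   argument [w] of [t] left out, does so [n * (|w| + 2)] times.  The constant
   makes the base of the power at least 2, even if [w] is empty. *)
Fixpoint power_term (k : nat) (f : term) : term :=
  if k is j.+1 then
    let t := power_term j f in
    pure comp_term <*> (pure comp_term <*> t <*> t) <*> (ask <*> t <*> t)
  else pure f.

Lemma power_typed k f L : is_lin L -> typed f (L -o L) ->
  typed (power_term k f) (farr W_Church (L -o L)).
Proof.
have formW : is_form W_Church by [].
move=> linL fL; elim: k => [|k IH] /=; first exact: pure_typed.
have comp := pure_typed formW (comp_typed linL).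
have double := share_lolli_typed formW (share_lolli_typed formW comp IH) IH.
have ask := ask_Church_typed linL.
have loop := share_arr_typed formW (share_arr_typed formW ask IH) IH.
exact: share_lolli_typed formW (share_lolli_typed formW comp double) loop.
Qed.

Lemma power_closed k f : closed f -> closed (power_term k f).
Proof.
move=> cf; elim: k => [|k IH] i /=; first by rewrite cf.
by rewrite !occ_closed.
Qed.

Lemma iterates_power k f w : closed f ->
  iterates f ((size w + 2) ^ k) (power_term k f \@ church w).
Proof.
move=> cf; elim: k => [|k IH].
  by have [_ ff] := maps_to_pure (church w) cf; apply: iterates_red ff _ => x.
set t := power_term k f in IH *; set n := (size w + 2) ^ k in IH.
have ct : closed t by apply: power_closed.
have tw := maps_to_refl (church w) ct.
have compw := maps_to_pure (church w) comp_closed.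
have [_ body_red] := maps_to_share
  (maps_to_share compw (maps_to_share (maps_to_share compw tw) tw))
  (maps_to_share (maps_to_share (maps_to_ask (church w)) tw) tw).
apply: iterates_red body_red _.
have -> : (size w + 2) ^ k.+1 = n + n + n * size w.
  by rewrite expnSr mulnDr; lia.
apply: iterates_comp => //; first exact: iterates_comp.
exact: iterates_church.
Qed.

(** * The simulating term *)

Definition input_term (M : turing) : term :=
  let letter b := cons_term \@ enc (Bit b : symbol (tm_aux M)) in
  ask <*> pure (letter false) <*> pure (letter true) <*> pure nil_term.

Lemma input_typed M : typed (input_term M) (farr W_Church list_form).
Proof.
have formW : is_form W_Church by [].
have letterT b : typed (cons_term \@ enc (Bit b : symbol (tm_aux M)))
    (list_form -o list_form) by affine.
apply: share_lolli_typed (pure_typed formW nil_typed) => //.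
apply: share_arr_typed (pure_typed formW (letterT true)) => //.
apply: share_arr_typed (pure_typed formW (letterT false)) => //.
exact: ask_Church_typed.
Qed.

Lemma maps_to_input M w : maps_to (church w) (input_term M)
  (enc_list [seq Bit b : symbol (tm_aux M) | b <- w]).
Proof.
pose letter b := cons_term \@ enc (Bit b : symbol (tm_aux M)).
apply: (maps_to_red
  (a := church w \@ letter false \@ letter true \@ nil_term)).
  by do 3 (apply: maps_to_share; last exact: maps_to_pure); apply: maps_to_ask.
apply: red_trans (church_red w _ _ _) _ => //.
by elim: w => //= -[] w IH; apply: cons_red.
Qed.

Definition right_term : term := tlam (tvar 0 \@ tlam (tlam (tlam (tvar 0)))).

Lemma right_typed : typed right_term (config_form -o list_form).
Proof. by rewrite /right_term; affine. Qed.

Lemma right_red M (c : config M) :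
  red (right_term \@ enc_config c) (enc_list (cf_right c)).
Proof. by rewrite /right_term /enc_config; head_reduce. Qed.

Definition run_term (M : turing) (k : nat) : term :=
  pure right_term <*> (power_term k (step_term M)
    <*> (pure (config_term \@ enc (tm_start M) \@ nil_term) <*> input_term M)).

Definition machine_term (M : turing) (k : nat) : term :=
  power_term k.+2 (read_term M) <*> pure (tlam nilW_term) <*> run_term M k.

Lemma run_typed M k : typed (run_term M k) (farr W_Church list_form).
Proof.
have formW : is_form W_Church by [].
have initT : typed (config_term \@ enc (tm_start M) \@ nil_term)
  (list_form -o config_form) by affine.
have init := share_lolli_typed formW (pure_typed formW initT) (input_typed M).
have steps := power_typed k (L := config_form) isT (step_typed M).
apply: share_lolli_typed (pure_typed formW right_typed) _ => //.
exact: share_lolli_typed formW steps init.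
Qed.

Lemma machine_typed M k : typed (machine_term M k) (farr W_Church W_Scott).
Proof.
have formW : is_form W_Church by [].
have emptyT : typed (tlam nilW_term) (list_form -o W_Scott) by affine.
apply: share_lolli_typed (run_typed M k) => //.
apply: share_lolli_typed (pure_typed formW emptyT) => //.
exact/power_typed/read_typed.
Qed.

Lemma maps_to_run M k w : maps_to (church w) (run_term M k)
  (enc_list (cf_right (iter ((size w + 2) ^ k) (@total_step M) (tm_init M w)))).
Proof.
have init_red : red (config_term \@ enc (tm_start M) \@ nil_term
      \@ enc_list [seq Bit b : symbol (tm_aux M) | b <- w])
    (enc_config (tm_init M w)) by apply: (@config_red _ _ [::]).
have right := maps_to_pure (church w) (dial_closed right_typed).
have step_closed := dial_closed (step_typed M).
have steps := maps_to_refl (church w) (power_closed k step_closed).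
have init_closed : closed (config_term \@ enc (tm_start M) \@ nil_term) by [].
have init := maps_to_share (maps_to_pure (church w) init_closed)
  (maps_to_input M w).
apply: maps_to_red (maps_to_share right (maps_to_share steps init)) _.
apply: red_trans (right_red _); apply: red_appr.
apply: red_trans (red_appr _ init_red) _.
by apply: red_trans (iter_step_red _ _); apply: iterates_power.
Qed.

Lemma polynomial_le_power c k n : c * n ^ k + c <= (n + 2) ^ (c + k.+1).
Proof.
have base_gt1 : 1 < n + 2 by rewrite addn2.
have nk_le : n ^ k <= (n + 2) ^ k.
  by case: k => // k; rewrite leq_exp2r // leq_addr.
rewrite -mulnSr expnD leq_mul //; first exact/ltnW/ltn_expl.
by apply: leq_ltn_trans nk_le _; rewrite ltn_exp2l.
Qed.

Lemma tape_size_le_power k n : n + ((n + 2) ^ k).*2 <= (n + 2) ^ k.+2.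
Proof.
have : 0 < (n + 2) ^ k by rewrite expn_gt0 addn2.
rewrite !expnSr; nia.
Qed.

Lemma machine_red M k w u N :
    tm_halts_within N (tm_init M w) u -> N <= (size w + 2) ^ k ->
  red (machine_term M k \@ church w) (scott u).
Proof.
move=> hu leN; rewrite -(iter_total_step_halts hu leN).
have read_closed := dial_closed (read_typed M).
have reader := maps_to_refl (church w) (power_closed k.+2 read_closed).
have empty_closed : closed (tlam nilW_term) by [].
have empty := maps_to_pure (church w) empty_closed.
have [_ red_read] :=
  maps_to_share (maps_to_share reader empty) (maps_to_run M k w).
apply: red_trans red_read _.
apply: red_trans (red_appl _ (iterates_power _ _ read_closed _)) _ => //.
apply: reads_iter; apply: leq_trans (tape_size_le_power k (size w)).
by rewrite (leq_trans (size_right_iter _ _)) //= size_map.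
Qed.

Theorem theorem2 (f : seq bool -> seq bool) (hf : polytime f) :
  exists t : term,
    dial [::] [::] t (farr W_Church W_Scott) /\
    forall w : seq bool, beta_nf_of (tapp t (church w)) (scott (f w)).
Proof.
have [M [c [k hM]]] := hf; exists (machine_term M (c + k.+1)); split.
  exact: machine_typed.
move=> w; split; last exact: scott_normal.
exact: machine_red (hM w) (polynomial_le_power c k (size w)).
Qed.
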